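(* Let $G$ be an infinite group acting with only finitely many orbits and almost freely on a connected two-ended graph $\Gamma$ without dominated ends. Then $G$ is two-ended.
   Context: Groups act on graphs by automorphisms, and orbits are orbits on the vertex set. The action is almost free if the stabilizer of every vertex is finite. Graphs are not assumed locally finite. A ray is a one-way infinite path; an end is an equivalence class of rays, two rays being equivalent if there is no finite vertex set $S$ such that they have tails in different components of $\Gamma\setminus S$; two-ended means having exactly two ends. For a finite vertex set $S$ and an end $\omega$, $C(S,\omega)$ denotes the component of $\Gamma\setminus S$ containing tails of the rays of $\omega$. A vertex $v$ dominates an end $\omega$ if there is no finite vertex set $S$ not containing $v$ with $v\notin C(S,\omega)$; an end is dominated if some vertex dominates it. The number of ends of a finitely generated group is the number of ends of any of its Cayley graphs with respect to a finite generating set; a group is two-ended if it is finitely generated and has exactly two ends. *)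

(* Defs.v *)
From mathcomp Require Import all_boot.
From mathcomp Require Import boolp classical_sets functions cardinality.
From Stdlib Require Import Relation_Operators.

Set Implicit Arguments.
Unset Strict Implicit.
Unset Printing Implicit Defensive.

Local Open Scope classical_set_scope.
Local Open Scope group_scope.

(* Simple undirected graphs on an arbitrary, possibly infinite, vertex type. *)
Record graph : Type := Graph {
  vertex :> Type;
  adj : vertex -> vertex -> Prop;
  adj_sym : forall x y, adj x y -> adj y x;
  adj_irrefl : forall x, ~ adj x x
}.

Section Ends.
Variable X : graph.
Implicit Types (S C : set X) (r s : nat -> X) (w : set (nat -> X)).

(* [joined S x y]: x and y lie outside S and some walk of X \ S links them. *)
Definition joined S (x y : X) : Prop :=
  [/\ ~ S x, ~ S y &
      clos_refl_trans X (fun u v => [/\ adj u v, ~ S u & ~ S v]) x y].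

Definition component S C : Prop := exists2 x, ~ S x & C = joined S x.

Definition connected_graph : Prop := forall x y : X, joined set0 x y.

Definition ray r : Prop := injective r /\ forall n, adj (r n) (r n.+1).

Definition has_tail_in r C : Prop :=
  exists N, forall n, (N <= n)%N -> C (r n).

Definition ray_equiv r s : Prop :=
  ~ exists S, finite_set S /\ exists C D,
      [/\ component S C, component S D, C <> D,
          has_tail_in r C & has_tail_in s D].

Definition ends : set (set (nat -> X)) :=
  [set w | exists2 r, ray r & w = [set s | ray s /\ ray_equiv r s]].

Definition two_ended : Prop := (ends #= `I_2)%card.

(* C(S, w); for S finite and w an end exactly one component qualifies, so the
   union below is that component. *)
Definition end_component S w : set X :=
  \bigcup_(C in [set C | component S C /\ forall r, w r -> has_tail_in r C]) C.

Definition dominates (v : X) w : Prop :=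
  ~ exists S, [/\ finite_set S, ~ S v & ~ end_component S w v].

Definition dominated w : Prop := exists v, dominates v w.

End Ends.

Arguments connected_graph : clear implicits.
Arguments ends : clear implicits.
Arguments two_ended : clear implicits.

Record graph_action (G : groupType) (X : graph) : Type := GraphAction {
  act :> G -> X -> X;
  act1 : forall x, act 1 x = x;
  actM : forall g h x, act (g * h) x = act g (act h x);
  act_adj : forall g x y, adj (act g x) (act g y) <-> adj x y
}.

Section Actions.
Variables (G : groupType) (X : graph) (a : graph_action G X).

Definition gorbit (x : X) : set X := range (fun g => a g x).

Definition gstab (x : X) : set G := [set g | a g x = x].

Definition finitely_many_orbits : Prop := finite_set (range gorbit).

Definition almost_free : Prop := forall x, finite_set (gstab x).

End Actions.

Section Cayley.
Variable G : groupType.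
Implicit Type S : set G.

Definition generates S : Prop :=
  smallest (fun H : set G => group_closed (mem H)) S = setT.

(* The right Cayley graph, without loops and with orientations and labels
   forgotten. *)
Definition cayley_adj S (g h : G) : Prop :=
  g <> h /\ exists2 s, S s & h = g * s \/ g = h * s.

Lemma cayley_adj_sym S g h : cayley_adj S g h -> cayley_adj S h g.
Proof. by move=> [gh [s Ss [e|e]]]; split; [exact/nesym| |exact/nesym|];
  exists s => //; [right|left]. Qed.

Lemma cayley_adj_irrefl S g : ~ cayley_adj S g g.
Proof. by case. Qed.

Definition cayley S : graph :=
  Graph (@cayley_adj_sym S) (@cayley_adj_irrefl S).

(* The number of ends of G does not depend on the finite generating set used,
   so the condition is imposed on all of its Cayley graphs. *)
Definition two_ended_group : Prop :=
  (exists S, finite_set S /\ generates S) /\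
  (forall S, finite_set S -> generates S -> two_ended (cayley S)).

End Cayley.

Arguments two_ended_group : clear implicits.

(* Main.v *)
Require Import Defs.
From mathcomp Require Import all_boot.
From mathcomp Require Import boolp classical_sets functions cardinality.
From Stdlib Require Import Relation_Operators.

Set Implicit Arguments.
Unset Strict Implicit.
Unset Printing Implicit Defensive.

Local Open Scope classical_set_scope.
Local Open Scope group_scope.

(** Let T be a finite connected vertex set separating the two ends; write C1, C2
for the components of the complement of T that contain the tails of rays of
the first and of the second end. The stabilizers being finite, only finitely
many group elements move T to a set that meets a given finite set, and as the
group permutes the two ends, every translate of T separates them too
([finite_meeting], [separates_act]).

If gT is disjoint from T, it lies in C1 or in C2: otherwise the union of C1, T
and C2 is a connected set avoiding gT that contains tails of both ends
([translate_sides]). The elements fixing both ends form a subgroup of index at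
most two, which is infinite, so some z in it has zT disjoint from T, say inside
C1; then z maps the union of T and C1 into C1 ([shift_nested]). Hence z has
infinite order, and for large n any given vertex lies on the side of the second
end of z^n T and on the side of the first end of z^-n T
([shift_eventually_behind]).

Let P be a finite connected set containing T, zT and z^-1 T. The translates of
P by the powers of z form a connected chain running from end to end, so a
translate hT avoiding the whole chain would not separate the ends. Thus hT meets
z^n P for some integer n, so z^-n h lies in the finite set Q of those q with qT
meeting P, and G is the union of the sets z^n Q ([shift_cofinite]).

It remains to see that such a group is two-ended. It is generated by z and Q. In
any Cayley graph for a finite generating set, the two halves of G made of the
z^n Q with n > N and with n < -N are non-adjacent for large N ([far_apart]) and
have a finite complement, and each of them eventually lies in one component of
the complement of any given finite set ([far_joined]). So each ray ends up in
one half, that half determines its end ([tends_dichotomy], [tends_same_end],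
[tends_apart]), and loop erasure of the walk through the powers of z gives a ray
in each half ([exists_tends]). *)

(** * Eventual properties and sets of two elements *)

Definition eventually (P : nat -> Prop) : Prop :=
  exists N, forall n, (N <= n)%N -> P n.

Lemma eventually_and (P Q : nat -> Prop) :
  eventually P -> eventually Q -> eventually (fun n => P n /\ Q n).
Proof.
move=> [N hN] [M hM]; exists (maxn N M) => n; rewrite geq_max => /andP[Nn Mn].
by split; [exact: hN|exact: hM].
Qed.

Lemma eventually_mono (P Q : nat -> Prop) :
  (forall n, P n -> Q n) -> eventually P -> eventually Q.
Proof. by move=> PQ [N hN]; exists N => n /hN /PQ. Qed.

Lemma eventually_exists (P : nat -> Prop) : eventually P -> exists n, P n.
Proof. by move=> [N hN]; exists N; exact: hN. Qed.

Lemma eventually_all T (F : set T) (P : T -> nat -> Prop) :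
  finite_set F -> (forall x, F x -> eventually (P x)) ->
  eventually (fun n => forall x, F x -> P x n).
Proof.
move=> + hP; have {hP} : forall x, exists N, F x -> forall n, (N <= n)%N -> P x n.
  move=> x; have [Fx|nFx] := pselect (F x); last by exists 0%N.
  by have [N hN] := hP x Fx; exists N.
move=> /choice[N hN] Ffin.
have /finite_seqP[s es] : finite_set (N @` F) by exact: finite_image.
exists (\max_(i <- s) i) => n sn x Fx; apply: (hN x Fx); apply: leq_trans sn.
have : (N @` F) (N x) by exists x.
by rewrite es /= => /(@leq_bigmax_seq _ s predT id (N x)); exact.
Qed.

Lemma eventually_notin T (f : nat -> T) (F : set T) :
  injective f -> finite_set F -> eventually (fun n => ~ F (f n)).
Proof.
move=> finj Ffin; apply: (@eventually_mono (fun n => forall x, F x -> f n <> x)).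
  by move=> n h Ffn; exact: (h _ Ffn).
apply: eventually_all => // x Fx.
have [[m <-]|h] := pselect (exists m, f m = x).
  by exists m.+1 => n mn /finj e; rewrite e ltnn in mn.
by exists 0%N => n _ e; apply: h; exists n.
Qed.

Lemma card_eq_I2P T (A : set T) :
  (A #= `I_2)%card <-> exists x y, x <> y /\ A = [set x; y].
Proof.
split=> [/card_set_bijP[f [fun_f inj_f surj_f]]|[x [y [xy ->]]]].
  have [x Ax fx] := surj_f 0%N erefl; have [y Ay fy] := surj_f 1%N erefl.
  exists x, y; split=> [exy|]; first by move: fx; rewrite exy fy.
  apply/seteqP; split=> [u Au|u [->|->]//].
  have := fun_f u Au; case eu : (f u) => [|[|//]] _ /=; [left|right].
    by apply: inj_f; rewrite ?inE // eu fx.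
  by apply: inj_f; rewrite ?inE // eu fy.
apply/card_set_bijP.
have xx : `[< x = x >] by exact/asboolP.
have yx : `[< y = x >] = false by apply/asboolF/nesym.
exists (fun u => if `[< u = x >] then 0%N else 1%N); split.
- by move=> u _ /=; case: ifP.
- by move=> u v; rewrite !inE => -[->|->] [->|->]; rewrite ?xx ?yx.
- by move=> [|[|//]] _; [exists x|exists y]; rewrite ?xx ?yx //=; [left|right].
Qed.

(** * Connected sets and ends of graphs *)

Section Separation.
Variable X : graph.
Implicit Types (S Y Z : set X) (r s : nat -> X).

(** Path induction from a fixed origin: nearly all uses of [joined] go through
it instead of through the closure operator of its definition. *)
Lemma joined_ind S x (P : X -> Prop) : P x ->
  (forall u v, ~ S u -> ~ S v -> adj u v -> P u -> P v) ->
  forall y, joined S x y -> P y.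
Proof.
move=> Px PS y [_ _ xy].
elim: xy Px => [u v [uv nSu nSv] /(PS _ _ nSu nSv uv)//|//|u v w _ IHu _ IHv].
by move=> /IHu/IHv.
Qed.

Lemma joined_refl S x : ~ S x -> joined S x x.
Proof. by move=> nSx; split => //; exact: rt_refl. Qed.

Lemma joined_trans S x y z : joined S x y -> joined S y z -> joined S x z.
Proof.
move=> [nSx _ xy] [_ nSz yz]; split => //; exact: rt_trans yz.
Qed.

Lemma joined_adj S x y : ~ S x -> ~ S y -> adj x y -> joined S x y.
Proof. by move=> nSx nSy xy; split => //; exact: rt_step. Qed.

Lemma joined_sym S x y : joined S x y -> joined S y x.
Proof.
move=> xy; have [nSx _ _] := xy.
elim/joined_ind: y / xy; first exact: joined_refl.
move=> u v nSu nSv uv ux; apply: joined_trans ux.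
by apply: joined_adj => //; exact: adj_sym.
Qed.

Lemma joined_sub S S' x y : S `<=` S' -> joined S' x y -> joined S x y.
Proof.
move=> SS' xy; have [nSx _ _] := xy.
elim/joined_ind: y / xy; first by apply: joined_refl => /SS'.
move=> u v nSu nSv uv ux; apply: joined_trans ux _.
by apply: joined_adj => // /SS'.
Qed.

(** Since [joined S] is about walks avoiding S, a walk inside Y is one that
avoids the complement of Y. *)
Definition connected_set Y : Prop := forall x y, Y x -> Y y -> joined (~` Y) x y.

(** The main device of the separation arguments: a finite set that two ends are
to be separated by must meet every connected set running between them. *)
Lemma conn_joined Y S x y :
  connected_set Y -> Y `&` S = set0 -> Y x -> Y y -> joined S x y.
Proof.
move=> cY YS Yx Yy; apply: joined_sub (cY _ _ Yx Yy) => z Sz Yz.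
by rewrite -[False]/(set0 z) -YS.
Qed.

Lemma conn_star Y p :
  Y p -> (forall x, Y x -> joined (~` Y) p x) -> connected_set Y.
Proof.
move=> Yp pY x y Yx Yy; apply: joined_trans (pY _ Yy); apply: joined_sym.
exact: pY.
Qed.

Lemma conn1 x : connected_set [set x].
Proof. by move=> _ _ -> ->; apply: joined_refl; apply. Qed.

Lemma conn_component S x : connected_set (joined S x).
Proof.
have [Sx|nSx] := pselect (S x); first by move=> y z [/(_ Sx)].
have xx := joined_refl nSx.
apply: (@conn_star _ x) => // y xy.
suff [] : joined S x y /\ joined (~` joined S x) x y by [].
elim/joined_ind: y / xy; first by split=> //; apply: joined_refl => /(_ xx).
move=> u v nSu nSv uv [xu xu'].
have xv : joined S x v by apply: joined_trans xu _; apply: joined_adj.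
split=> //; apply: joined_trans xu' _.
by apply: joined_adj => //; apply.
Qed.

Lemma connU_adj Y Z p q : connected_set Y -> connected_set Z ->
  Y p -> Z q -> adj p q ->
  connected_set (Y `|` Z).
Proof.
move=> cY cZ Yp Zq pq.
have sub W W' : W `<=` W' -> ~` W' `<=` ~` W by move=> WW' x nx /WW'.
apply: (@conn_star _ p) => [|x [Yx|Zx]]; first by left.
  apply: joined_sub (cY _ _ Yp Yx); apply: sub; exact: subsetUl.
apply: (@joined_trans _ _ q).
  by apply: joined_adj => //; apply; [left|right].
apply: joined_sub (cZ _ _ Zq Zx); apply: sub; exact: subsetUr.
Qed.

Lemma connU Y Z p : connected_set Y -> connected_set Z -> Y p -> Z p ->
  connected_set (Y `|` Z).
Proof.
move=> cY cZ Yp Zp.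
have sub W W' : W `<=` W' -> ~` W' `<=` ~` W by move=> WW' x nx /WW'.
apply: (@conn_star _ p) => [|x [Yx|Zx]]; first by left.
  apply: joined_sub (cY _ _ Yp Yx); apply: sub; exact: subsetUl.
apply: joined_sub (cZ _ _ Zp Zx); apply: sub; exact: subsetUr.
Qed.

Lemma finite_conn_path x y : connected_graph X ->
  exists P, [/\ finite_set P, connected_set P, P x & P y].
Proof.
move=> Xc; elim/joined_ind: y / (Xc x y).
  by exists [set x]; split => //; exact: conn1.
move=> u v _ _ uv [P [Pfin cP Px Pu]]; exists (P `|` [set v]); split.
- by rewrite finite_setU; split => //; exact: finite_set1.
- exact: (connU_adj cP (@conn1 v) Pu (erefl v) uv).
- by left.
- by right.
Qed.

Lemma finite_conn_superset S : connected_graph X -> finite_set S ->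
  exists P, [/\ finite_set P, connected_set P & S `<=` P].
Proof.
move=> Xc Sfin; have [[x Sx]|nS] := pselect (exists x, S x); last first.
  by exists set0; split=> // x Sx; case: nS; exists x.
have /choice[P hP] y := finite_conn_path x y Xc.
exists (\bigcup_(y in S) P y); split.
- by apply: bigcup_finite => // y _; have [] := hP y.
- apply: (@conn_star _ x) => [|y [z Sz Py]].
    by exists x => //; have [] := hP x.
  have [_ cz zx _] := hP z; apply: joined_sub (cz _ _ zx Py).
  by move=> u nu Pu; apply: nu; exists z.
- by move=> y Sy; exists y => //; have [] := hP y.
Qed.

(** For a finite S, this is the component C(S, w) with w the end of r. Being
defined from a single representative it needs no choice of component, and it
behaves well under graph automorphisms. *)
Definition toward r S : set X := fun x => eventually (fun n => joined S x (r n)).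

Lemma toward_notin r S x : toward r S x -> ~ S x.
Proof. by move=> /eventually_exists[n []]. Qed.

(** An injective sequence leaves the finite set S for good, and from then on its
consecutive vertices are joined. *)
Lemma ray_toward r S : ray r -> finite_set S ->
  eventually (fun n => toward r S (r n)).
Proof.
move=> [rinj radj] Sfin; have [N hN] := eventually_notin rinj Sfin.
suff rj m k : (N <= m)%N -> joined S (r m) (r (m + k)%N).
  exists N => n Nn; exists n => m nm.
  by rewrite -(subnKC nm); exact: rj.
move=> Nm; elim: k => [|k IH]; first by rewrite addn0; apply/joined_refl/hN.
apply: joined_trans IH _; rewrite addnS; apply: joined_adj => //; apply: hN.
  exact: leq_trans Nm (leq_addr _ _).
by rewrite -addnS; exact: leq_trans Nm (leq_addr _ _).
Qed.

Lemma toward_joined r S x y : toward r S x -> joined S x y -> toward r S y.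
Proof.
move=> rx xy; apply: eventually_mono rx => n xn.
exact: joined_trans (joined_sym xy) xn.
Qed.

Lemma joined_toward r S x y : toward r S x -> toward r S y -> joined S x y.
Proof.
move=> rx ry; have [n [xn yn]] := eventually_exists (eventually_and rx ry).
exact: joined_trans xn (joined_sym yn).
Qed.

Lemma toward_component r S x : toward r S x -> toward r S = joined S x.
Proof.
move=> rx; apply/seteqP; split=> y; first exact: joined_toward.
exact: toward_joined.
Qed.

Lemma conn_toward r S : connected_set (toward r S).
Proof.
by move=> x y rx; rewrite (toward_component rx); apply: conn_component;
  apply: joined_refl; exact: toward_notin rx.
Qed.

Lemma component_toward r S C :
  component S C -> has_tail_in r C -> C = toward r S.
Proof.
move=> [x nSx ->] rx; symmetry; exact: toward_component.
Qed.

Lemma toward_conn r S Y x y : connected_set Y -> Y `&` S = set0 -> Y x -> Y y ->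
  toward r S x -> toward r S y.
Proof. by move=> cY YS Yx Yy /toward_joined; apply; exact: (conn_joined cY). Qed.

(** To place a vertex x on the side of r it is enough to find a connected set
off S that contains x and a tail of r. *)
Lemma toward_tail r S Y x : connected_set Y -> Y `&` S = set0 ->
  eventually (fun n => Y (r n)) -> Y x -> toward r S x.
Proof.
move=> cY YS rY Yx; apply: eventually_mono rY => n Yn.
exact: (conn_joined cY).
Qed.

Lemma toward_sub r S S' : S `<=` S' -> toward r S' `<=` toward r S.
Proof. by move=> SS' x; apply: eventually_mono => n; exact: joined_sub. Qed.

(** In a connected graph every component of the complement of S is adjacent to S,
as seen on a walk from the component to S. *)
Lemma conn_toward_setU r S : connected_graph X ->
  finite_set S -> connected_set S -> S !=set0 -> ray r ->
  connected_set (toward r S `|` S).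
Proof.
move=> Xc Sfin cS [s Ss] rr.
have [n rn] := eventually_exists (ray_toward rr Sfin).
have [[_ /(_ Ss) //]|[u [v [ru Sv uv]]]] : joined S (r n) s \/
    exists u v, [/\ toward r S u, S v & adj u v].
  elim/joined_ind: s / (Xc (r n) s) {Ss} => [|u v _ _ uv [nu|]]; last by right.
    by left; apply: joined_refl; exact: toward_notin rn.
  have ru := toward_joined rn nu.
  have [Sv|nSv] := pselect (S v); first by right; exists u, v.
  left; apply: joined_trans nu _; apply: joined_adj => //.
  exact: toward_notin ru.
exact: connU_adj (@conn_toward r S) cS ru Sv uv.
Qed.

(** A form of ray equivalence whose being an equivalence relation is immediate;
[ray_equivP] shows that it is the same notion. *)
Definition same_end r s : Prop :=
  forall S, finite_set S -> toward r S = toward s S.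

Lemma ray_equivP r s : ray r -> ray s -> ray_equiv r s <-> same_end r s.
Proof.
move=> rr rs; split => [rs_eq S Sfin|rs_eq [S [Sfin [C [D [cC cD CD rC sD]]]]]].
  apply: contrapT => ne; apply: rs_eq; exists S; split=> //.
  have comp t : ray t -> component S (toward t S).
    move=> rt; have [n tn] := eventually_exists (ray_toward rt Sfin).
    by exists (t n); [exact: toward_notin tn|exact: toward_component].
  by exists (toward r S), (toward s S); split => //;
    [exact: comp|exact: comp|exact: ray_toward|exact: ray_toward].
by apply: CD; rewrite (component_toward cC rC) (component_toward cD sD) rs_eq.
Qed.

Lemma same_end_sym r s : same_end r s -> same_end s r.
Proof. by move=> rs S /rs. Qed.

Lemma same_end_trans r s t : same_end r s -> same_end s t -> same_end r t.
Proof. by move=> rs st S Sfin; rewrite rs // st. Qed.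

(** Two rays representing the two ends of a two-ended graph; this trades
statements on classes of rays for statements on rays, see [two_endedP]. *)
Record end_pair r1 r2 : Prop := EndPair {
  end_pair_ray1 : ray r1;
  end_pair_ray2 : ray r2;
  end_pair_neq : ~ same_end r1 r2;
  end_pair_all : forall s, ray s -> same_end s r1 \/ same_end s r2
}.

Lemma end_pair_sym r1 r2 : end_pair r1 r2 -> end_pair r2 r1.
Proof.
move=> [ray1 ray2 neq all]; split=> // [/same_end_sym //|s /all[]]; by [right|left].
Qed.

Definition end_class r : set (nat -> X) := [set s | ray s /\ ray_equiv r s].

Lemma end_class_eq r s : ray r -> ray s ->
  end_class r = end_class s <-> same_end r s.
Proof.
move=> rr rs; split=> [e|rs_same].
  have : end_class s s by split=> //; apply/(ray_equivP rs rs).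
  by rewrite -e => -[_ /(ray_equivP rr rs)].
apply/seteqP; split=> t [rt].
  move=> /(ray_equivP rr rt) rt_same; split=> //; apply/(ray_equivP rs rt).
  exact: same_end_trans (same_end_sym rs_same) rt_same.
move=> /(ray_equivP rs rt) st_same; split=> //; apply/(ray_equivP rr rt).
exact: same_end_trans rs_same st_same.
Qed.

Lemma two_endedP : two_ended X <-> exists r1 r2 : nat -> X, end_pair r1 r2.
Proof.
rewrite /two_ended; split=> [/card_eq_I2P[e1 [e2 [ne eE]]]|
  [r1 [r2 [ray1 ray2 neq all]]]].
  have [r1 ray1 e1E] : ends X e1 by rewrite eE; left.
  have [r2 ray2 e2E] : ends X e2 by rewrite eE; right.
  exists r1, r2; split=> // [/(end_class_eq ray1 ray2) e|s rs].
    by apply: ne; rewrite e1E e2E.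
  have : ends X (end_class s) by exists s.
  by rewrite eE => -[]; [rewrite e1E|rewrite e2E] => e; [left|right];
    apply/end_class_eq => //.
apply/card_eq_I2P; exists (end_class r1), (end_class r2); split.
  by move/(end_class_eq ray1 ray2).
apply/seteqP; split=> [_ [s rs ->]|_ [->|->]]; last 2 first.
- by exists r1.
- by exists r2.
by have [h|h] := all s rs; [left|right]; apply/end_class_eq => //.
Qed.

End Separation.

(** * Translates of finite separators *)

Section Translates.
Variables (G : groupType) (X : graph) (a : graph_action G X).
Implicit Types (S T Y : set X) (r s : nat -> X).

Lemma actVK g x : a g^-1 (a g x) = x.
Proof. by rewrite -actM mulVg act1. Qed.

Lemma actKV g x : a g (a g^-1 x) = x.
Proof. by rewrite -actM mulgV act1. Qed.

Lemma act_inj g : injective (a g).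
Proof. exact: can_inj (actVK g). Qed.

Lemma act_image1 S : a 1 @` S = S.
Proof.
by apply/seteqP; split=> [_ [x Sx <-]|x Sx]; [rewrite act1|exists x; rewrite ?act1].
Qed.

Lemma act_imageM g h S : a (g * h) @` S = a g @` (a h @` S).
Proof.
rewrite image_comp; congr (_ @` S); apply/funext => x; exact: actM.
Qed.

Lemma act_image_setC g S : ~` (a g @` S) = a g @` (~` S).
Proof.
apply/seteqP; split=> [x nx|_ [x nSx <-] [y Sy /act_inj e]].
  by exists (a g^-1 x); rewrite ?actKV // => Sx; apply: nx; exists (a g^-1 x);
    rewrite ?actKV.
by apply: nSx; rewrite -e.
Qed.

Lemma mem_act_image g S x : (a g @` S) (a g x) <-> S x.
Proof. by split=> [[y Sy /act_inj <-]|Sx]; [|exists x]. Qed.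

Lemma joined_act g S x y : joined S x y -> joined (a g @` S) (a g x) (a g y).
Proof.
move=> xy; have [nSx _ _] := xy.
elim/joined_ind: y / xy; first by apply: joined_refl => /mem_act_image.
move=> u v nSu nSv uv xu; apply: joined_trans xu _.
by apply: joined_adj; [move/mem_act_image|move/mem_act_image|exact/act_adj].
Qed.

Lemma conn_act g Y : connected_set Y -> connected_set (a g @` Y).
Proof.
move=> cY _ _ [x Yx <-] [y Yy <-]; rewrite act_image_setC.
exact/joined_act/cY.
Qed.

Lemma ray_act g r : ray r -> ray (a g \o r).
Proof.
move=> [rinj radj]; split=> [|n]; last exact/act_adj.
exact: inj_comp (@act_inj g) rinj.
Qed.

Lemma toward_act g r S : toward (a g \o r) (a g @` S) = a g @` toward r S.
Proof.
apply/seteqP; split=> [x rx|_ [x rx <-]].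
  exists (a g^-1 x); last exact: actKV.
  apply: eventually_mono rx => n /(joined_act g^-1).
  by rewrite -act_imageM mulVg act_image1 /= actVK.
by apply: eventually_mono rx => n; exact: joined_act.
Qed.

Lemma same_end_act g r s : same_end r s -> same_end (a g \o r) (a g \o s).
Proof.
move=> rs S Sfin; rewrite -(act_image1 S) -(mulgV g) act_imageM !toward_act.
by rewrite rs //; exact: finite_image.
Qed.

Lemma same_end_actV g r s : same_end (a g \o r) s -> same_end r (a g^-1 \o s).
Proof.
move=> /(same_end_act g^-1) h; apply: same_end_trans h.
by have -> : a g^-1 \o (a g \o r) = r by apply/funext => n /=; rewrite actVK.
Qed.

(** The elements mapping x to y form a coset of the stabilizer of x. *)
Lemma finite_meeting S T : almost_free a -> finite_set S -> finite_set T ->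
  finite_set [set g | a g @` S `&` T !=set0].
Proof.
move=> free Sfin Tfin.
apply: (@sub_finite_set _ _
  (\bigcup_(x in S) \bigcup_(y in T) [set g | a g x = y])).
  by move=> g [_ [[x Sx <-] Tx]]; exists x => //; exists (a g x).
apply: bigcup_finite => // x _; apply: bigcup_finite => // y _.
have [[g0 g0x]|no] := pselect (exists g, a g x = y); last first.
  by apply: (sub_finite_set _ (@finite_set0 G)) => g gx; apply: no; exists g.
apply: (sub_finite_set _ (finite_image (fun h => g0 * h) (free x))) => g /= gx.
exists (g0^-1 * g); last by rewrite mulgA mulgV mul1g.
by rewrite /gstab /= actM gx -g0x actVK.
Qed.

End Translates.

Section TwoEnds.
Variables (G : groupType) (X : graph) (a : graph_action G X).
Hypotheses (Xconn : connected_graph X) (free : almost_free a).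
Implicit Types (S T Y : set X) (r s : nat -> X).

Definition separates r1 r2 T : Prop := toward r1 T `&` toward r2 T = set0.

Lemma separates_sym r1 r2 T : separates r1 r2 T -> separates r2 r1 T.
Proof. by rewrite /separates setIC. Qed.

Lemma separatesN r1 r2 T x : separates r1 r2 T -> toward r1 T x ->
  toward r2 T x -> False.
Proof. by move=> sep x1 x2; rewrite -[False]/(set0 x) -sep. Qed.

(** Distinct ends differ at some finite S; adding vertices to S keeps the two
components disjoint, so S may be enlarged to a nonempty connected set. *)
Lemma exists_separator r1 r2 : end_pair r1 r2 ->
  exists T, [/\ finite_set T, connected_set T, T !=set0 & separates r1 r2 T].
Proof.
move=> [ray1 ray2 neq _].
have [S [Sfin neqS]] : exists S, finite_set S /\ toward r1 S <> toward r2 S.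
  apply: contrapT => h; apply: neq => S Sfin; apply: contrapT => neqS.
  by apply: h; exists S.
have [T [Tfin cT ST]] : exists T, [/\ finite_set T, connected_set T &
    S `|` [set r1 0%N] `<=` T].
  apply: finite_conn_superset => //.
  by rewrite finite_setU; split=> //; exact: finite_set1.
exists T; split=> //; first by exists (r1 0%N); apply: ST; right.
rewrite /separates -subset0 => x [x1 x2]; apply: neqS.
have sub : S `<=` T by move=> y Sy; apply: ST; left.
by rewrite (toward_component (toward_sub sub x1)) (toward_component (toward_sub sub x2)).
Qed.

(** The images of inequivalent rays are inequivalent, so the two ends cannot be
mapped to the same one. *)
Lemma act_end_pair r1 r2 g : end_pair r1 r2 ->
  (same_end (a g \o r1) r1 /\ same_end (a g \o r2) r2) \/
  (same_end (a g \o r1) r2 /\ same_end (a g \o r2) r1).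
Proof.
move=> [ray1 ray2 neq all].
have nsame s : ~ (same_end (a g \o r1) s /\ same_end (a g \o r2) s).
  move=> [h1 h2]; apply: neq; apply: same_end_trans (same_end_actV h1) _.
  exact/same_end_sym/same_end_actV.
have [h1|h1] := all _ (ray_act a g ray1); have [h2|h2] := all _ (ray_act a g ray2).
- by case: (nsame r1).
- by left.
- by right.
- by case: (nsame r2).
Qed.

Lemma separates_act r1 r2 T g : end_pair r1 r2 -> finite_set T ->
  separates r1 r2 T -> separates r1 r2 (a g @` T).
Proof.
move=> pair Tfin sep; have gTfin := finite_image (a g) Tfin.
rewrite /separates; have [[h1 h2]|[h1 h2]] := act_end_pair g pair.
- rewrite -(h1 _ gTfin) -(h2 _ gTfin) !toward_act -subset0.
  by move=> _ [[x x1 <-] /mem_act_image]; exact: separatesN x1.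
- rewrite -(h1 _ gTfin) -(h2 _ gTfin) !toward_act -subset0.
  by move=> _ [[x x2 <-] /mem_act_image x1]; exact: separatesN x1 x2.
Qed.

Definition fixes_ends r1 r2 g : Prop :=
  same_end (a g \o r1) r1 /\ same_end (a g \o r2) r2.

Lemma fixes_endsV r1 r2 g : fixes_ends r1 r2 g -> fixes_ends r1 r2 g^-1.
Proof. by move=> [h1 h2]; split; exact/same_end_sym/same_end_actV. Qed.

Lemma comp_actM g h r : a (g * h) \o r = a g \o (a h \o r).
Proof. by apply/funext => n /=; rewrite actM. Qed.

Lemma fixes_endsM r1 r2 g h :
  fixes_ends r1 r2 g -> fixes_ends r1 r2 h -> fixes_ends r1 r2 (g * h).
Proof.
move=> [g1 g2] [h1 h2]; split; rewrite comp_actM.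
  exact: same_end_trans (same_end_act a g h1) g1.
exact: same_end_trans (same_end_act a g h2) g2.
Qed.

(** If k exchanges the ends, k^-1 maps the coset of all elements exchanging them
into the group of those fixing them. *)
Lemma infinite_fixes_ends r1 r2 : infinite_set [set: G] -> end_pair r1 r2 ->
  infinite_set [set g | fixes_ends r1 r2 g].
Proof.
move=> Ginf pair fin; apply: Ginf.
have [[k nk]|all] := pselect (exists k, ~ fixes_ends r1 r2 k); last first.
  by apply: sub_finite_set fin => g _; apply: contrapT => ng; apply: all; exists g.
apply: (@sub_finite_set _ _ ([set g | fixes_ends r1 r2 g] `|`
  (fun h => k * h) @` [set g | fixes_ends r1 r2 g])); last first.
  by rewrite finite_setU; split=> //; exact: finite_image.
move=> g _; have [[g1 g2]|[g1 g2]] := act_end_pair g pair; first by left.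
right; exists (k^-1 * g); last by rewrite mulgA mulgV mul1g.
have [[k1 k2]|[k1 k2]] := act_end_pair k pair; first by case: nk.
split; rewrite comp_actM.
  apply: same_end_trans (same_end_act a k^-1 g1) _.
  exact/same_end_sym/same_end_actV.
apply: same_end_trans (same_end_act a k^-1 g2) _.
exact/same_end_sym/same_end_actV.
Qed.

Lemma toward_fixed g r T : finite_set T -> same_end (a g \o r) r ->
  toward r (a g @` T) = a g @` toward r T.
Proof. by move=> Tfin gr; rewrite -gr ?toward_act//; exact: finite_image. Qed.

Lemma act_image_nonempty g T : T !=set0 -> a g @` T !=set0.
Proof. by move=> [t Tt]; exists (a g t); exists t. Qed.

Lemma toward_setU_disjoint r1 r2 T Y : separates r1 r2 T ->
  Y `<=` toward r1 T -> (toward r2 T `|` T) `&` Y = set0.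
Proof.
move=> sep Yr; rewrite -subset0 => x [[x2|Tx] /Yr x1].
  exact: separatesN sep x1 x2.
by case: (toward_notin x1).
Qed.

(** Suppose gT, which is connected, meets neither component. Then T together
with either component is connected off gT, so the points of T are on both
sides of gT, although gT separates the ends. *)
Lemma translate_sides r1 r2 T g : end_pair r1 r2 -> finite_set T -> connected_set T ->
  T !=set0 -> separates r1 r2 T -> a g @` T `&` T = set0 ->
  a g @` T `<=` toward r1 T \/ a g @` T `<=` toward r2 T.
Proof.
move=> pair Tfin cT T0 sep gTT; have [t Tt] := T0.
have [ray1 ray2 _ _] := pair.
have cgT : connected_set (a g @` T) by exact: conn_act.
have sub r x : (a g @` T) x -> toward r T x -> a g @` T `<=` toward r T.
  by move=> gx rx y gy; exact: toward_conn cgT gTT gx gy rx.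
have [[x [gx x1]]|no1] := pselect (exists x, (a g @` T) x /\ toward r1 T x).
  by left; exact: sub gx x1.
have [[x [gx x2]]|no2] := pselect (exists x, (a g @` T) x /\ toward r2 T x).
  by right; exact: sub gx x2.
have tow r : ray r -> ~ (exists x, (a g @` T) x /\ toward r T x) ->
    toward r (a g @` T) t.
  move=> rr no; apply: (toward_tail (Y := toward r T `|` T)).
  - exact: conn_toward_setU.
  - rewrite -subset0 => x [[rx|Tx] gx]; first by apply: no; exists x.
    by rewrite -[set0 x]/(set0 x) -gTT.
  - by apply: eventually_mono (ray_toward rr Tfin) => n; left.
  - by right.
have gsep := separates_act g pair Tfin sep.
by case: (separatesN gsep (tow _ ray1 no1) (tow _ ray2 no2)).
Qed.

(** The element z acts as a translation from the second end to the first: it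
moves T, and then all of C(T, r1), into C(T, r1). Every consequence is needed in
both directions; [shiftV] gives the second for free by exchanging the ends and
inverting z. *)
Record shift r1 r2 T z : Prop := Shift {
  shift_pair : end_pair r1 r2;
  shift_finite : finite_set T;
  shift_conn : connected_set T;
  shift_nonempty : T !=set0;
  shift_separates : separates r1 r2 T;
  shift_fixes : fixes_ends r1 r2 z;
  shift_sub : a z @` T `<=` toward r1 T
}.

Lemma exists_shift r1 r2 : infinite_set [set: G] -> end_pair r1 r2 ->
  exists s1 s2 T z, shift s1 s2 T z.
Proof.
move=> Ginf pair; have [T [Tfin cT T0 sep]] := exists_separator pair.
have /infinite_setN0[z [zfix zT]] := infinite_setD
  (infinite_fixes_ends Ginf pair) (finite_meeting free Tfin Tfin).
have zTT : a z @` T `&` T = set0.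
  by apply: contrapT => /eqP/set0P.
have [sub|sub] := translate_sides pair Tfin cT T0 sep zTT.
  by exists r1, r2, T, z.
exists r2, r1, T, z; split=> //; [exact: end_pair_sym|exact: separates_sym|].
by case: zfix.
Qed.

Section Shift.
Variables (r1 r2 : nat -> X) (T : set X) (z : G) (sh : shift r1 r2 T z).

(** Seen from zT, everything in T or beyond it is on the side of r2. *)
Lemma shift_behind : toward r2 T `|` T `<=` toward r2 (a z @` T).
Proof.
have [pair Tfin cT T0 sep _ sub] := sh; have ray2 := end_pair_ray2 pair.
move=> x; apply: toward_tail; first exact: conn_toward_setU.
  exact: toward_setU_disjoint sub.
by apply: eventually_mono (ray_toward ray2 Tfin) => n; left.
Qed.

(** C(zT, r1) is connected and avoids T, since T is on the other side of zT. *)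
Lemma shift_nested : toward r1 (a z @` T) `<=` toward r1 T.
Proof.
have [pair Tfin _ _ sep _ _] := sh.
move=> x; apply: toward_tail; first exact: conn_toward.
  rewrite -subset0 => y [y1 Ty]; apply: separatesN y1 _.
    exact: separates_act sep.
  by apply: shift_behind; right.
apply: ray_toward; [exact: end_pair_ray1 pair|exact: finite_image].
Qed.

End Shift.

Lemma shiftV r1 r2 T z : shift r1 r2 T z -> shift r2 r1 T z^-1.
Proof.
move=> sh; have [pair Tfin cT T0 sep zfix sub] := sh; split=> //.
- exact: end_pair_sym.
- exact: separates_sym.
- by have [] := fixes_endsV zfix.
- move=> _ [t Tt <-]; have : toward r2 (a z @` T) t.
    by apply: (shift_behind sh); right.
  by rewrite toward_fixed //; [move=> [x x2 <-]; rewrite actVK|case: zfix].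
Qed.

Lemma shiftX r1 r2 T z n : shift r1 r2 T z -> shift r1 r2 T (z ^+ n.+1).
Proof.
move=> sh; elim: n => [|n IH]; first by rewrite expg1.
have [pair Tfin cT T0 sep zfix sub] := sh; have [_ _ _ _ _ zfixn subn] := IH.
split=> //; rewrite expgS; first exact: fixes_endsM.
rewrite act_imageM; apply: subset_trans (shift_nested sh).
by rewrite toward_fixed //; [exact: image_subset|case: zfix].
Qed.

(** Positive powers of z are shifts, and the identity is not, because it maps T
to itself. *)
Lemma shift_expg_inj r1 r2 T z : shift r1 r2 T z -> injective (fun n => z ^+ n).
Proof.
move=> sh.
have nlt m n : (m < n)%N -> z ^+ m <> z ^+ n.
  move=> mn e; have : z ^+ (n - m.+1).+1 = 1.
    apply: (@mulgI _ (z ^+ m)); rewrite -expgnDr mulg1 -subSn // subSS.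
    by rewrite subnKC // ltnW.
  move=> e1; have := shiftX (n - m.+1) sh; rewrite e1.
  move=> [_ _ _ [t Tt] _ _ sub].
  by have /toward_notin := sub (a 1 t) (imageP _ Tt); rewrite act1.
move=> m n /= e; case: (ltngtP m n) => // h; first by case: (nlt _ _ h).
by case: (nlt _ _ h).
Qed.

(** A finite connected set joining x to T is avoided by almost all z^n T, hence
lies on one side of them, and T is on the side of r2. *)
Lemma shift_eventually_behind r1 r2 T z x : shift r1 r2 T z ->
  eventually (fun n => toward r2 (a (z ^+ n) @` T) x).
Proof.
move=> sh; have [_ Tfin _ [t Tt] _ _ _] := sh.
have [P [Pfin cP Pt Px]] := finite_conn_path t x Xconn.
have [N hN] := eventually_notin (shift_expg_inj sh) (finite_meeting free Tfin Pfin).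
exists N.+1 => -[//|n] Nn; apply: (toward_conn cP _ Pt Px).
  rewrite setIC; apply: contrapT => /eqP/set0P; exact/hN/ltnW.
by apply: (shift_behind (shiftX n sh)); right.
Qed.

(** The half C(zT, r1) together with zT is a connected set avoiding Y. *)
Lemma shift_toward_self r1 r2 T z Y : shift r1 r2 T z ->
  Y `<=` toward r2 (a z @` T) -> (a z @` T) `<=` toward r1 Y.
Proof.
move=> [pair Tfin cT T0 sep _ _] Y2 x zx; have ray1 := end_pair_ray1 pair.
have zTfin := finite_image (a z) Tfin.
apply: (toward_tail (Y := toward r1 (a z @` T) `|` a z @` T)).
- by apply: conn_toward_setU => //; [exact: conn_act|exact: act_image_nonempty].
- apply: toward_setU_disjoint Y2 => //; exact/separates_sym/separates_act.
- by apply: eventually_mono (ray_toward ray1 zTfin) => n; left.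
- by right.
Qed.

(** The chain of translates: z^n P and z^(n+1) P share the vertex z^(n+1) t. *)
Lemma joined_expg Y P z t : connected_set P -> P t -> P (a z t) ->
  (forall n, a (z ^+ n) @` P `&` Y = set0) ->
  forall n, joined Y t (a (z ^+ n) t).
Proof.
move=> cP Pt Pzt PY; elim=> [|n IH].
  rewrite act1; apply: joined_refl => Yt.
  by have : set0 t by rewrite -(PY 0%N) act_image1.
apply: joined_trans IH _; rewrite expgSr actM.
by apply: (conn_joined (conn_act (g := z ^+ n) cP) (PY n)); exact/mem_act_image.
Qed.

(** If hT avoided every z^n P and every z^-n P, then a vertex t of T would be
joined off hT to z^n t and z^-n t for all n. For large n these are on the two
sides of hT, so t would be on both. *)
Lemma shift_cofinite r1 r2 T z : shift r1 r2 T z -> exists Q,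
  finite_set Q /\ forall h, exists n q, Q q /\ (h = z ^+ n * q \/ h = z^-1 ^+ n * q).
Proof.
move=> sh; have [pair Tfin cT [t Tt] sep zfix sub] := sh.
have [P [Pfin cP TP]] : exists P, [/\ finite_set P, connected_set P &
    T `|` (a z @` T `|` a z^-1 @` T) `<=` P].
  apply: finite_conn_superset => //; rewrite !finite_setU.
  by split=> //; split; exact: finite_image.
have Pt : P t by apply: TP; left.
have Pzt : P (a z t) by apply: TP; right; left; exists t.
have PzVt : P (a z^-1 t) by apply: TP; right; right; exists t.
exists [set q | a q @` T `&` P !=set0]; split; first exact: finite_meeting.
move=> h; apply: contrapT => no.
have hTfin := finite_image (a h) Tfin.
have disj y : (forall n q, h = y ^+ n * q -> ~ (a q @` T `&` P !=set0)) ->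
    forall n, a (y ^+ n) @` P `&` (a h @` T) = set0.
  move=> ny n; rewrite -subset0 => _ [[p Pp <-] [u Tu hu]].
  apply: (ny n ((y ^+ n)^-1 * h)); first by rewrite mulgA mulgV mul1g.
  by exists p; split=> //; exists u => //; rewrite actM hu actVK.
have jz n : joined (a h @` T) t (a (z ^+ n) t).
  apply: (joined_expg cP) => //; apply: disj => m q e hq; apply: no.
  by exists m, q; split=> //; left.
have jzV n : joined (a h @` T) t (a (z^-1 ^+ n) t).
  apply: (joined_expg cP) => //; apply: disj => m q e hq; apply: no.
  by exists m, q; split=> //; right.
have tow y s1 s2 : shift s1 s2 T y -> (forall n, joined (a h @` T) t (a (y ^+ n) t)) ->
    toward s1 (a h @` T) t.
  move=> shy jy.
  have [N hN] := eventually_all hTfin (fun x _ => shift_eventually_behind x shy).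
  have sub' := shift_toward_self (shiftX N shy) (hN N.+1 (leqnSn N)).
  apply: toward_joined (joined_sym (jy N.+1)); apply: sub'; exact: imageP.
apply: (separatesN (separates_act h pair Tfin sep)).
  exact: tow sh jz.
exact: tow (shiftV sh) jzV.
Qed.

End TwoEnds.

(** * Rays from walks *)

Section Walks.
Variable X : graph.

(** A walk visiting each vertex finitely often contains a ray: from each vertex
proceed with the step following the last visit to it. *)
Lemma loop_erasure (w : nat -> X) : (forall n, adj (w n) (w n.+1)) ->
  (forall x, eventually (fun n => w n <> x)) ->
  exists l : nat -> nat, (forall k, (k <= l k)%N) /\ ray (w \o l).
Proof.
move=> wadj wprop.
(* L n is the time of the last visit to the vertex w n. *)
have /choice[L hL] n : exists m, [/\ (n <= m)%N, w m = w n &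
    forall k, (m < k)%N -> w k <> w n].
  have [N hN] := wprop (w n).
  have ex : exists k, `[< w k = w n >] by exists n; apply/asboolP.
  have bd k : `[< w k = w n >] -> (k <= N)%N.
    by move=> /asboolP e; rewrite leqNgt; apply/negP => /ltnW/hN.
  case: (ex_maxnP ex bd) => m /asboolP mn mmax; exists m; split=> //.
    by apply: mmax; apply/asboolP.
  by move=> k mk /asboolP/mmax; rewrite leqNgt mk.
pose l := fix l k := if k is k'.+1 then L (l k').+1 else L 0%N.
have lS k : (l k < l k.+1)%N by have [] := hL (l k).+1.
have lmono i j : (i < j)%N -> (l i < l j)%N.
  elim: j => // j IH; rewrite ltnS leq_eqVlt => /orP[/eqP->//|/IH h].
  exact: ltn_trans (lS j).
have last k m : (l k < m)%N -> w m <> w (l k).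
  by case: k => [|k] /=; [have [_ e h] := hL 0%N|have [_ e h] := hL (l k).+1];
    rewrite e; exact: h.
exists l; split; first by elim=> // k IH; exact: leq_ltn_trans (lS k).
split=> [i j /= e|k /=]; last by have [_ -> _] := hL (l k).+1.
by case: (ltngtP i j) => // /lmono /last; rewrite e.
Qed.

(** The values of w beyond m are junk; a total function is convenient for
repeating the walk periodically in [exists_tends]. *)
Lemma joined_walk x y : joined set0 x y -> exists m (w : nat -> X),
  [/\ w 0%N = x, w m = y & forall i, (i < m)%N -> adj (w i) (w i.+1)].
Proof.
move=> xy; elim/joined_ind: y / xy; first by exists 0%N, (fun=> x).
move=> u v _ _ uv [m [w [w0 wm wadj]]].
exists m.+1, (fun i => if (i <= m)%N then w i else v); split=> //.
  by rewrite ltnn.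
move=> i; rewrite ltnS => im; rewrite im; case: ltnP => [/wadj//|mi].
have -> : i = m by apply/eqP; rewrite eqn_leq im.
by rewrite wm.
Qed.

End Walks.

(** * Cayley graphs of virtually infinite cyclic groups *)

Section Cayley.
Variables (G : groupType) (S : set G).
Hypothesis (Sfin : finite_set S) (Sgen : generates S).

Lemma lmul_adj (g x y : cayley S) :
  adj (g * x : cayley S) (g * y : cayley S) <-> adj x y.
Proof.
split=> -[xy [s Ss e]]; split.
- by move=> e'; apply: xy; rewrite e'.
- by exists s => //; case: e; rewrite -mulgA => /mulgI ->; [left|right].
- by move=> /mulgI.
- by exists s => //; case: e => ->; rewrite mulgA; [left|right].
Qed.

Definition cayley_action : graph_action G (cayley S) :=
  @GraphAction G (cayley S) (fun g x => g * x) (@mul1g G)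
    (fun g h x => esym (mulgA g h x)) lmul_adj.

Lemma generatesP : generates S <-> forall H : set G, S `<=` H -> H 1 ->
  (forall x y, H x -> H y -> H (x * y^-1)) -> forall x, H x.
Proof.
split=> [gen H SH H1 HD x|h].
  have : [set: G] x by [].
  rewrite -gen; apply; split=> //; split; first by apply/mem_set.
  by move=> u v /set_mem Hu /set_mem Hv; apply/mem_set/HD.
apply/seteqP; split=> // x _ H [[H1 HD] SH]; apply: h x => //.
  exact/set_mem.
by move=> x y Hx Hy; apply/set_mem/HD; exact/mem_set.
Qed.

Lemma cayley_connected : connected_graph (cayley S).
Proof.
have tr (g x y : cayley S) : joined set0 x y ->
    joined set0 (g * x : cayley S) (g * y : cayley S).
  by move=> /(joined_act cayley_action g); rewrite image_set0.
have to1 : forall x : cayley S, joined set0 (1 : cayley S) x.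
  move/generatesP: Sgen; apply.
  - move=> s Ss; have [<-|ns] := pselect (1 = s); first exact: joined_refl.
    by apply: joined_adj => //; split=> //; exists s => //; left; rewrite mul1g.
  - exact: joined_refl.
  - move=> x y x1 y1; apply: joined_trans x1 _.
    by have := tr (x * y^-1) _ _ (joined_sym y1); rewrite mulg1 mulgVK.
by move=> x y; apply: joined_trans (to1 y); exact: joined_sym.
Qed.

End Cayley.

Section Line.
Variable G : groupType.

(** The infinite cyclic group generated by z has finite index, Q containing
representatives of its right cosets. Negative powers are written as powers of
z^-1, so that exchanging z and z^-1 is a symmetry of everything below. *)
Record virtual_generator (z : G) (Q : set G) : Prop := VirtualGenerator {
  vgen_inj : injective (fun n => z ^+ n);
  vgen_finite : finite_set Q;
  vgen_cover : forall h, exists n q, Q q /\ (h = z ^+ n * q \/ h = z^-1 ^+ n * q)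
}.

Lemma vgenV z Q : virtual_generator z Q -> virtual_generator z^-1 Q.
Proof.
move=> [inj Qfin cov]; split=> // [m n|h].
  by rewrite !expVgn => /invg_inj/inj.
have [n [q [Qq e]]] := cov h; exists n, q; split=> //; rewrite invgK.
by case: e; [right|left].
Qed.

Lemma vgen_finitely_generated z Q : virtual_generator z Q ->
  exists S : set G, finite_set S /\ generates S.
Proof.
move=> [_ Qfin cov]; exists (z |` Q); split.
  by rewrite finite_setU; split=> //; exact: finite_set1.
apply/generatesP => H SH H1 HD x.
have HV y : H y -> H y^-1 by move=> Hy; rewrite -[y^-1]mul1g; exact: HD.
have HM u v : H u -> H v -> H (u * v).
  by move=> Hu Hv; rewrite -[v]invgK; exact/HD/HV.
have HX y n : H y -> H (y ^+ n).
  by move=> Hy; elim: n => // n IH; rewrite expgS; exact: HM.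
have Hz : H z by apply: SH; left.
have [n [q [Qq [->|->]]]] := cov x; apply: HM; try (by apply: SH; right).
  exact: HX.
exact/HX/HV.
Qed.

(** A neighbourhood of the end that z points to; the opposite end has the
neighbourhoods [far z^-1 Q N]. *)
Definition far (z : G) (Q : set G) N : set G :=
  fun x => exists n q, [/\ (N <= n)%N, Q q & x = z ^+ n * q].

Lemma far_le z Q M N : (M <= N)%N -> far z Q N `<=` far z Q M.
Proof.
by move=> MN x [n [q [Nn Qq e]]]; exists n, q; split=> //; exact: leq_trans Nn.
Qed.

Lemma finite_not_far z Q N : virtual_generator z Q ->
  finite_set (~` (far z Q N `|` far z^-1 Q N)).
Proof.
move=> [_ Qfin cov].
apply: (@sub_finite_set _ _ (\bigcup_(n in `I_N)
    ((fun q => z ^+ n * q) @` Q `|` (fun q => z^-1 ^+ n * q) @` Q))).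
  move=> x nx; have [n [q [Qq e]]] := cov x.
  have nN : (n < N)%N.
    rewrite ltnNge; apply/negP => Nn; apply: nx.
    by case: e => e; [left|right]; exists n, q.
  by exists n => //; case: e => ->; [left|right]; exists q.
apply: bigcup_finite => // n _; rewrite finite_setU; split; exact: finite_image.
Qed.

Lemma expg_eventually_far z Q N p : virtual_generator z Q ->
  eventually (fun n => far z Q N (z ^+ n * p)).
Proof.
move=> [_ _ /(_ p)[k [q [Qq pE]]]]; exists (N + k)%N => n Nkn.
have kn : (k <= n)%N by apply: leq_trans Nkn; exact: leq_addl.
case: pE => ->; rewrite mulgA.
  exists (n + k)%N, q; split=> //; last by rewrite expgnDr.
  by apply: leq_trans (leq_addr _ _); apply: leq_trans Nkn; exact: leq_addr.
exists (n - k)%N, q; split=> //; first by rewrite leq_subRL // addnC.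
by rewrite expVgn expgnFr.
Qed.

Section Fixed.
Variables (S Q : set G).
Hypothesis (Sfin : finite_set S) (Sgen : generates S).
Let K := cayley S.
Implicit Types (r s : nat -> K) (z : G).

(** Translate a walk from x to y by z^n: as z has infinite order, each vertex of
the walk is in F for only finitely many n. *)
Lemma expg_joined z (F : set K) (x y : K) : virtual_generator z Q -> finite_set F ->
  eventually (fun n => joined F (z ^+ n * x : K) (z ^+ n * y : K)).
Proof.
move=> [inj _ _] Ffin.
have out (u : K) : eventually (fun n => ~ F (z ^+ n * u)).
  by apply: eventually_notin => // m n /mulIg/inj.
elim/joined_ind: y / (cayley_connected Sgen x y).
  by apply: eventually_mono (out x) => n; exact: joined_refl.
move=> u v _ _ uv IH.
apply: eventually_mono (eventually_and IH (eventually_and (out u) (out v))).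
move=> n [xu [nu nv]]; apply: joined_trans xu _; apply: joined_adj => //.
exact/lmul_adj.
Qed.

Lemma far_joined z (F : set K) : virtual_generator z Q -> finite_set F ->
  exists N, forall x y : K, far z Q N x -> far z Q N y -> joined F x y.
Proof.
move=> vz Ffin.
have [N hN] := eventually_and (expg_joined 1 z vz Ffin)
  (eventually_all (vgen_finite vz) (fun q _ => expg_joined 1 q vz Ffin)).
have next n : (N <= n)%N -> joined F (z ^+ n : K) (z ^+ n.+1 : K).
  by move=> /hN[+ _]; rewrite mulg1 expgSr.
have base n : joined F (z ^+ N : K) (z ^+ (N + n) : K).
  elim: n => [|n IH].
    by rewrite addn0; apply: joined_refl; have [] := next N (leqnn N).
  by rewrite addnS; apply: joined_trans IH _; apply: next; exact: leq_addr.
have all x : far z Q N x -> joined F (z ^+ N : K) x.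
  move=> [n [q [Nn Qq ->]]]; have [_ /(_ q Qq)] := hN n Nn.
  rewrite mulg1; apply: joined_trans; have := base (n - N)%N.
  by rewrite subnKC.
exists N => x y /all xN /all; apply: joined_trans; exact: joined_sym.
Qed.

(** If z^n q and z^-m q' are equal or adjacent, then z^-(n+m) belongs to a
finite set D depending only on Q and S. This bounds n + m. *)
Lemma far_apart z : virtual_generator z Q -> exists N, forall u v : K,
  far z Q N u -> far z^-1 Q N v -> u <> v /\ ~ adj u v.
Proof.
move=> vz; have [_ Qfin _] := vz.
pose D := \bigcup_(q in Q) \bigcup_(q' in Q)
  (fun g => q * g * q'^-1) @` (1 |` (S `|` (fun g => g^-1) @` S)).
have Dfin : finite_set D.
  apply: bigcup_finite => // q _; apply: bigcup_finite => // q' _.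
  apply: finite_image; rewrite !finite_setU; split; first exact: finite_set1.
  by split=> //; exact: finite_image.
have [N hN] := eventually_notin (vgen_inj (vgenV vz)) Dfin.
have key (u v g : G) : far z Q N u -> far z^-1 Q N v ->
    v = u * g -> (1 |` (S `|` (fun g => g^-1) @` S)) g -> False.
  move=> [n [q [Nn Qq ->]]] [m [q' [Nm Qq' ->]]] e Ss.
  apply: (hN (n + m)%N); first exact: leq_trans (leq_addr _ _).
  exists q => //; exists q' => //; exists g => //.
  apply: (@mulIg _ q'); rewrite mulgVK expgnDr -(mulgA _ _ q') e.
  by rewrite -(mulgA _ q g) expVgn mulKg.
exists N => u v hu hv; split=> [e|[_ [s Ss [e|e]]]].
- by apply: (key u v 1 hu hv); [rewrite mulg1|left].
- by apply: (key u v s hu hv) => //; right; left.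
- by apply: (key u v s^-1 hu hv); [rewrite e mulgK|right; right; exists s].
Qed.

Definition tends r z : Prop := forall N, eventually (fun n => far z Q N (r n)).

Lemma tends_same_end r s z : virtual_generator z Q ->
  tends r z -> tends s z -> same_end r s.
Proof.
move=> vz; suff sub r' s' : tends r' z -> tends s' z ->
    forall F, finite_set F -> toward r' F `<=` toward s' F.
  by move=> rz sz F Ffin; apply/seteqP; split; exact: sub.
move=> rz sz F Ffin x rx; have [N hN] := far_joined vz Ffin.
apply: eventually_mono (eventually_and rx (eventually_and (rz N) (sz N))).
by move=> n [xr [rn sn]]; apply: joined_trans xr _; exact: hN.
Qed.

Lemma tends_apart r s z : virtual_generator z Q -> ray r -> ray s ->
  tends r z -> tends s z^-1 -> ~ same_end r s.
Proof.
move=> vz rr rs rz sz rs_same; have [N hN] := far_apart vz.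
pose F : set K := ~` (far z Q N `|` far z^-1 Q N).
have Ffin : finite_set F by exact: finite_not_far.
have [n [[rn rF] [sn sF]]] := eventually_exists (eventually_and
  (eventually_and (rz N) (ray_toward rr Ffin))
  (eventually_and (sz N) (ray_toward rs Ffin))).
rewrite -(rs_same _ Ffin) in sF.
suff : far z Q N (s n) by move=> /hN/(_ sn)[].
elim/joined_ind: (s n) / (joined_toward rF sF) => // u v nFu + uv zu.
by move=> /contrapT[//|/(hN _ _ zu)[]].
Qed.

(** A ray leaves the finite complement of the two halves, and cannot cross from
one half to the other, as they are not adjacent. *)
Lemma tends_dichotomy r z : virtual_generator z Q -> ray r ->
  tends r z \/ tends r z^-1.
Proof.
move=> vz [rinj radj]; have [N0 hN0] := far_apart vz.
have side N := eventually_notin rinj (finite_not_far N vz).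
have [M hM] := side N0.
have cases n : (M <= n)%N -> far z Q N0 (r n) \/ far z^-1 Q N0 (r n).
  by move=> /hM/contrapT.
have [zM|zM] := cases M (leqnn M).
  have stay : eventually (fun n => far z Q N0 (r n)).
    exists M => n /subnKC <-; elim: (n - M)%N => [|k IH]; rewrite ?addn0 // addnS.
    have [//|h] := cases (M + k).+1 (leqW (leq_addr _ _)).
    by have [_ /(_ (radj _))] := hN0 _ _ IH h.
  left=> N; apply: eventually_mono (eventually_and (side (maxn N N0)) stay).
  move=> n [/contrapT[h _|h1 h2]]; first exact: far_le (leq_maxl _ _) _ h.
  by have [] := hN0 _ _ h2 (far_le (leq_maxr _ _) h1).
have stay : eventually (fun n => far z^-1 Q N0 (r n)).
  exists M => n /subnKC <-; elim: (n - M)%N => [|k IH]; rewrite ?addn0 // addnS.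
  have [h|//] := cases (M + k).+1 (leqW (leq_addr _ _)).
  by have [_ []] := hN0 _ _ h IH; exact/adj_sym/radj.
right=> N; apply: eventually_mono (eventually_and (side (maxn N N0)) stay).
move=> n [/contrapT[h1 h2|h _]]; last exact: far_le (leq_maxl _ _) _ h.
by have [] := hN0 _ _ (far_le (leq_maxr _ _) h1) h2.
Qed.

(** Repeating translates of a walk p from 1 to z gives an infinite walk through
the powers of z, whose n-th vertex is z^(n / m) p(n mod m) with m the length
of p. It visits each vertex finitely often, so its loops can be erased. *)
Lemma exists_tends z : virtual_generator z Q -> exists r, ray r /\ tends r z.
Proof.
move=> vz.
have [m [p [p0 pm padj]]] := joined_walk (cayley_connected Sgen 1 z).
have m0 : (0 < m)%N.
  case: m pm {padj} => // pz; have := @vgen_inj _ _ vz 0%N 1%N.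
  by rewrite expg0 expg1 -p0 -pz => /(_ erefl).
pose w n : K := z ^+ (n %/ m) * p (n %% m)%N.
have wadj n : adj (w n) (w n.+1).
  have [lt|ge] := ltnP (n %% m).+1 m.
    have -> : w n.+1 = z ^+ (n %/ m) * p (n %% m).+1.
      rewrite /w {1 2}(divn_eq n m) -addnS divnMDl // modnMDl.
      by rewrite (divn_small lt) addn0 (modn_small lt).
    by apply/lmul_adj/padj; exact: ltnW.
  have e : (n %% m).+1 = m by apply/eqP; rewrite eqn_leq ge ltn_pmod.
  have -> : w n.+1 = z ^+ (n %/ m) * p (n %% m).+1.
    rewrite /w {1 2}(divn_eq n m) -addnS e -mulSnr mulnK // modnMl.
    by rewrite p0 mulg1 pm expgSr.
  by apply/lmul_adj/padj; exact: ltn_pmod.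
have wtends : tends w z.
  move=> N; have [M hM] := eventually_all (finite_image p (finite_II m))
    (fun x _ => expg_eventually_far N x vz).
  exists (M * m)%N => n Mn; apply: hM; first by rewrite leq_divRL.
  by exists (n %% m)%N => //=; exact: ltn_pmod.
have [l [kl rl]] : exists l : nat -> nat, (forall k, (k <= l k)%N) /\ ray (w \o l).
  apply: loop_erasure => // x.
  have [N hN] := far_joined vz (finite_set1 (x : K)).
  by apply: eventually_mono (wtends N) => n wn e; have [] := hN _ _ wn wn.
exists (w \o l); split=> // N; have [M hM] := wtends N.
by exists M => k Mk; apply: hM; exact: leq_trans (kl k).
Qed.

Lemma cayley_two_ended z : virtual_generator z Q -> two_ended K.
Proof.
move=> vz; have vzV := vgenV vz.
have [r [rr rz]] := exists_tends vz; have [s [rs sz]] := exists_tends vzV.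
apply/two_endedP; exists r, s; split=> //; first exact: tends_apart sz.
move=> t rt; have [tz|tz] := tends_dichotomy vz rt; [left|right].
  exact: tends_same_end tz rz.
exact: tends_same_end tz sz.
Qed.

End Fixed.

Lemma vgen_two_ended_group z Q : virtual_generator z Q -> two_ended_group G.
Proof.
move=> vz; split; first exact: vgen_finitely_generated vz.
by move=> S Sfin Sgen; exact: cayley_two_ended vz.
Qed.

End Line.

Theorem corollary4p5 (G : groupType) (X : graph) (a : graph_action G X)
    (Ginf : infinite_set [set: G]%classic)
    (orb : finitely_many_orbits a)
    (free : almost_free a)
    (Xconn : connected_graph X)
    (Xends : two_ended X)
    (Xdom : forall w, ends X w -> ~ dominated w) :
  two_ended_group G.
Proof.
have [r1 [r2 pair]] := (two_endedP X).1 Xends.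
have [s1 [s2 [T [z sh]]]] := exists_shift Xconn free Ginf pair.
have [Q [Qfin cov]] := shift_cofinite Xconn free sh.
by apply: (@vgen_two_ended_group _ z Q); split=> //; exact: shift_expg_inj sh.
Qed.
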